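(* Let $f:P\times X\to Y$ be a $K$-convex and $K$-closed map, let $C:P\rightrightarrows X$ be a closed and convex set-valued map, let $(\bar p,\bar x)\in \mathrm{gph}\,\mathcal S$ and $\bar y=f(\bar p,\bar x)$. Let $H:P\rightrightarrows P\times X$ be defined by $H(p)=\{p\}\times C(p)$. Suppose that (i) $\mathbb{R}^+(\mathrm{rge}\,H-\mathrm{dom}\,f)$ is a closed subspace of $P\times X$; (ii) $\mathbb{R}^+(P-\mathrm{dom}\,C)$ is a closed subspace of $P$; and that $F$ is $K$-dominated by the proper perturbation map $\mathcal P$ near $\bar p$. Then, for every $y^*\in Y^*$, $$\widehat D^*(\mathcal P+K)(\bar p,\bar y)(y^* )=\bigcup_{(p^*,x^* )\in D^*(f+K)(\bar p,\bar x)(y^* )}\Big\{p^*+D^*C(\bar p,\bar x)(x^* )\Big\}.$$ In particular, for every $y^*\in K^*$, $$\widehat D^*(\mathcal P+K)(\bar p,\bar y)(y^* )=\bigcup_{(p^*,x^* )\in \partial\langle y^*,f\rangle(\bar p,\bar x)}\Big\{p^*+D^*C(\bar p,\bar x)(x^* )\Big\}.$$ In particular, if $f$ is continuously differentiable at $(\bar p,\bar x)$, then for every $y^*\in K^*$, $$\widehat D^*(\mathcal P+K)(\bar p,\bar y)(y^* )=\nabla_p f(\bar p,\bar x)^*(y^* )+D^*C(\bar p,\bar x)\big(\nabla_x f(\bar p,\bar x)^*(y^* )\big).$$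
   Context: $X,Y,P$ are Banach spaces with duals $X^*,Y^*,P^*$; products carry the norm $\|(x,y)\|=\|x\|+\|y\|$. $K\subseteq Y$ is a pointed, closed, convex cone with apex at the origin, and $K^*=\{y^*\in Y^*\mid \langle y^*,k\rangle\ge 0\ \forall k\in K\}$. For a set $\Omega$, $\mathbb{R}^+(\Omega)=\mathrm{cone}\,\Omega=\{\lambda a\mid \lambda\ge 0,\ a\in\Omega\}$. For a set-valued map $G:U\rightrightarrows V$ between Banach spaces: $\mathrm{dom}\,G=\{u\mid G(u)\ne\emptyset\}$, $\mathrm{gph}\,G=\{(u,v)\mid v\in G(u)\}$, $\mathrm{rge}\,G=\bigcup_{u\in U}G(u)$. $G$ is convex (closed) if $\mathrm{gph}\,G$ is convex (closed). If $V=Y$, $\mathrm{epi}\,G=\{(u,y)\mid y\in G(u)+K\}$, $G$ is $K$-convex ($K$-closed) if $\mathrm{epi}\,G$ is convex (closed), and the profile map is $(G+K)(u)=G(u)+K$, so that $\mathrm{gph}(G+K)=\mathrm{epi}\,G$. All set-valued maps are assumed proper (nonempty domain). A single-valued map is regarded as the set-valued map with singleton values. For a convex set-valued map $G$ and $(\bar u,\bar v)\in\mathrm{gph}\,G$, the coderivative is $D^*G(\bar u,\bar v)(v^* )=\{u^*\in U^*\mid (u^*,-v^* )\in N((\bar u,\bar v),\mathrm{gph}\,G)\}$ for $v^*\in V^*$, where for a convex set $\Omega$ and $\bar w\in\Omega$, $N(\bar w,\Omega)=\{w^*\mid \langle w^*,w-\bar w\rangle\le 0\ \forall w\in\Omega\}$.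 $D^*(f+K)(\bar p,\bar x)$ denotes the coderivative of $f+K$ at the point $((\bar p,\bar x),f(\bar p,\bar x))$. For an arbitrary (possibly nonconvex) $G$ and $(\bar u,\bar v)\in\mathrm{gph}\,G$, the Fréchet coderivative is $\widehat D^*G(\bar u,\bar v)(v^* )=\{u^*\in U^*\mid (u^*,-v^* )\in\widehat N((\bar u,\bar v),\mathrm{gph}\,G)\}$, where for a set $\Omega$ and $\bar w\in\Omega$, $\widehat N(\bar w,\Omega)=\{w^*\mid \limsup_{w\to\bar w,\,w\in\Omega}\frac{\langle w^*,w-\bar w\rangle}{\|w-\bar w\|}\le 0\}$. $\partial$ is the subdifferential of convex analysis and $\langle y^*,f\rangle(p,x)=\langle y^*,f(p,x)\rangle$. $\nabla_pf(\bar p,\bar x)^*$ and $\nabla_xf(\bar p,\bar x)^*$ are the adjoints of the partial derivatives. $F:P\rightrightarrows Y$ is the objective map $F(p)=\{y\in Y\mid \exists x\in C(p),\ y=f(p,x)\}$. For nonempty $A\subseteq Y$, $\mathrm{Min}_KA=\{a\in A\mid (A-a)\cap(-K\setminus\{0\})=\emptyset\}$, and $\mathrm{PrMin}_KA$ (Henig proper minimal points) is the set of $a\in A$ for which there exists a convex cone $Q\subsetneqq Y$ with $K\setminus\{0\}\subseteq\mathrm{int}\,Q$ and $(A-a)\cap(-Q\setminus l(Q))=\emptyset$, where $l(Q)=Q\cap(-Q)$; both are empty when $A=\emptyset$. The proper perturbation map is the set-valued map $\mathcal P(p)=\mathrm{PrMin}_KF(p)$ (not to be confused with the space $P$), and $\mathcal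 S(p)=\{x\in C(p)\mid f(p,x)\in\mathrm{Min}_KF(p)\}$ is the solution map. $F$ is $K$-dominated by $\mathcal P$ near $\bar p$ if $F(p)\subseteq\mathcal P(p)+K$ for all $p$ in some neighborhood of $\bar p$. *)

(* Defs.v *)
From HB Require Import structures.
From mathcomp Require Import all_boot all_order all_algebra.
From mathcomp Require Import all_classical all_reals all_analysis.

Set Implicit Arguments.
Unset Strict Implicit.
Unset Printing Implicit Defensive.

Import Order.TTheory GRing.Theory Num.Theory.
Import numFieldNormedType.Exports.

Local Open Scope classical_set_scope.
Local Open Scope ring_scope.

Section SetAlgebra.
Context {R : realType} {V : lmodType R}.
Implicit Types (A B K Q : set V) (a : V).

Definition sumset A B : set V := [set a + b | a in A & b in B].

Definition diffset A B : set V := [set a - b | a in A & b in B].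

Definition oppset A : set V := [set - a | a in A].

Definition cone_hull A : set V := [set l *: a | l in [set l : R | 0 <= l] & a in A].

(* Cones have their apex at the origin and contain it. *)
Definition convex_cone K : Prop :=
  [/\ K !=set0, (forall (l : R) k, 0 <= l -> K k -> K (l *: k)) & convex_set K].

Definition lineality Q : set V := Q `&` oppset Q.

Definition pointed K : Prop := K `&` oppset K = [set 0].

Definition Min K A : set V :=
  [set a | A a /\ diffset A [set a] `&` oppset (K `\ 0) = set0].

End SetAlgebra.

Definition closed_subspace {R : realType} {V : normedModType R} (A : set V) :=
  [/\ closed A, A 0 & forall (l : R) (u v : V), A u -> A v -> A (l *: u + v)].

Definition PrMin {R : realType} {V : normedModType R} (K A : set V) : set V :=
  [set a | A a /\ exists Q : set V,
    [/\ convex_cone Q, Q `<` [set: V], K `\ 0 `<=` interior Q &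
        diffset A [set a] `&` (oppset Q `\` lineality Q) = set0]].

Section Dual.
Context {R : realType}.

(* The topological dual, as a set of functions. *)
Definition dual_space (V : normedModType R) : set (V -> R) :=
  [set vs : V -> R | scalar vs /\ continuous vs].

(* The functional (us, vs) on a product, under (U x V)^* = U^* x V^*. *)
Definition dpair (U V : normedModType R) (us : U -> R) (vs : V -> R) :
    U * V -> R :=
  fun w => us w.1 + vs w.2.

(* The same identification for a set of functionals on U x V.  Both components
   are required to be in the dual: this does not follow from dpair us vs being
   linear, since us and vs could be shifted by opposite constants. *)
Definition dual_pairs (U V : normedModType R) (G : set (U * V -> R)) :
    set ((U -> R) * (V -> R)) :=
  [set z | [/\ dual_space z.1, dual_space z.2 & G (dpair z.1 z.2)]].

Definition dual_cone (V : normedModType R) (K : set V) : set (V -> R) :=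
  [set vs : V -> R | dual_space vs /\ forall k, K k -> 0 <= vs k].

Definition normal_cone (W : normedModType R) (w0 : W) (O : set W) :
    set (W -> R) :=
  [set ws : W -> R | dual_space ws /\ forall w, O w -> ws (w - w0) <= 0].

Definition subdifferential (W : normedModType R) (phi : W -> R) (w0 : W) :
    set (W -> R) :=
  [set ws : W -> R | dual_space ws /\ forall w, ws (w - w0) <= phi w - phi w0].

(* The library's norm on U * V is the maximum norm; it induces the same
   topology as this one. *)
Definition sumnorm (U V : normedModType R) (w : U * V) : R := `|w.1| + `|w.2|.

Definition frechet_normal_cone (U V : normedModType R) (w0 : U * V)
    (O : set (U * V)) : set (U * V -> R) :=
  [set ws : U * V -> R | dual_space ws /\
    (limf_esup (fun w : U * V => (ws (w - w0) / sumnorm (w - w0))%:E)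
               (within O w0^') <= 0)%E].

End Dual.

Section SetValuedMaps.
Context {R : realType} {U V : normedModType R}.
Implicit Types (G : U -> set V) (g : U -> V) (K : set V).

Definition single g : U -> set V := fun u => [set g u].

Definition sdom G : set U := [set u | G u !=set0].

Definition gph G : set (U * V) := [set w | G w.1 w.2].

Definition rge G : set V := \bigcup_u G u.

Definition proper_map G : Prop := sdom G !=set0.

Definition profile G K : U -> set V := fun u => sumset (G u) K.

Definition epi G K : set (U * V) := [set w | sumset (G w.1) K w.2].

Definition Kconvex G K : Prop := convex_set (epi G K).

Definition Kclosed G K : Prop := closed (epi G K).

Definition coderivative G (u0 : U) (v0 : V) (vs : V -> R) : set (U -> R) :=
  [set us : U -> R | dual_space us /\
            normal_cone (u0, v0) (gph G) (dpair us (\- vs))].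

Definition frechet_coderivative G (u0 : U) (v0 : V) (vs : V -> R) :
    set (U -> R) :=
  [set us : U -> R | dual_space us /\
            frechet_normal_cone (u0, v0) (gph G) (dpair us (\- vs))].

End SetValuedMaps.

(* Frechet differentiable around w0, with a derivative that is continuous at w0
   for the operator norm. *)
Definition continuously_differentiable_at {R : realType}
    {U V W : normedModType R} (f : U * V -> W) (w0 : U * V) : Prop :=
  (\forall w \near w0, differentiable f w) /\
  forall e : R, 0 < e ->
    \forall w \near w0, forall h, `|'d f w h - 'd f w0 h| <= e * sumnorm h.

Section VectorOptimization.
Context {R : realType} {P X Y : normedModType R}.
Implicit Types (f : P * X -> Y) (C : P -> set X) (K : set Y).

Definition objective f C : P -> set Y :=
  fun p => [set y | exists x, C p x /\ y = f (p, x)].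

Definition proper_perturbation f C K : P -> set Y :=
  fun p => PrMin K (objective f C p).

Definition solution_map f C K : P -> set X :=
  fun p => [set x | C p x /\ Min K (objective f C p) (f (p, x))].

Definition graph_map C : P -> set (P * X) := fun p => [set p] `*` C p.

Definition K_dominated_near (F G : P -> set Y) K (p0 : P) : Prop :=
  \forall p \near p0, F p `<=` sumset (G p) K.

(* Adjoints of the partial derivatives, as maps Y^* -> P^* and Y^* -> X^*. *)
Definition grad_p_adj f (p0 : P) (x0 : X) (ys : Y -> R) : P -> R :=
  fun h => ys ('d (fun p => f (p, x0)) p0 h).

Definition grad_x_adj f (p0 : P) (x0 : X) (ys : Y -> R) : X -> R :=
  fun h => ys ('d (fun x => f (p0, x)) x0 h).

End VectorOptimization.

(* Main.v *)
Require Import Defs.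
From HB Require Import structures.
From mathcomp Require Import all_boot all_order all_algebra.
From mathcomp Require Import all_classical all_reals all_analysis.
From mathcomp Require Import lra.

Set Implicit Arguments.
Unset Strict Implicit.
Unset Printing Implicit Defensive.

Import Order.TTheory GRing.Theory Num.Theory.
Import numFieldNormedType.Exports.

Local Open Scope classical_set_scope.
Local Open Scope ring_scope.

(** Since f is single-valued and everywhere defined, the whole theorem rests on
    a subdifferential sum rule for the convex function <ys, f> and the convex
    set gph C.

    The Frechet coderivative is first traded for a convex one.  Near pbar the
    domination property makes the profiles of the perturbation map and of the
    objective map F coincide, and the graph of F + K is convex because epi f and
    gph C are.  A Frechet normal of a set that agrees near a point with a convex
    set is a convex normal of the latter
    ([frechet_normal_cone_locally_convex]).  So ps belongs to the left-hand side
    exactly when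
      <ps, p - pbar> <= <ys, f (p, x) + k - ybar>
    for all x in C p and k in K.  In particular ys is nonnegative on K.

    It remains to split ps ([coderivative_objective]).  The inequality says that
    the linear functional (p, x) |-> <ps, p> lies below the convex function
    g v = <ys, f (w0 + v) - f w0> on the convex set gph C - w0, where
    w0 = (pbar, xbar).  The sandwich theorem ([sandwich_convex]), which is
    Hahn-Banach for a suitable sublinear functional, yields a linear l <= g with
    l >= ps on gph C - w0: the first inequality is a subgradient inequality for
    <ys, f>, the second says that ps - l is normal to gph C.

    Completeness enters only to see that l is continuous.  For this it suffices
    that g be bounded above near 0 ([scalarization_bounded_above]), a
    consequence of the Robinson-Ursescu argument: epi f is closed, convex and
    projects onto P * X, so by the Baire category theorem bounded elements
    y of f w + K can be chosen for all w near w0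
    ([locally_bounded_selection]), and <ys, f w> <= <ys, y>.

    For ys in K^* the coderivative of f + K is the subdifferential of <ys, f>
    ([coderivative_scalarization]), and when f is differentiable that
    subdifferential is the single functional ys o f'(w0)
    ([subdifferential_diff]). *)

(** * Linear functionals *)

Section scalar_theory.
Context {R : realType} {V : lmodType R} {l : V -> R} (ll : scalar l).

Lemma is_scalarD x y : l (x + y) = l x + l y.
Proof. by have := ll 1 x y; rewrite scale1r mul1r. Qed.

Lemma is_scalar0 : l 0 = 0.
Proof. by have := is_scalarD 0 0; rewrite addr0; lra. Qed.

Lemma is_scalarZ t x : l (t *: x) = t * l x.
Proof. by have := ll t x 0; rewrite !addr0 is_scalar0 addr0. Qed.

Lemma is_scalarN x : l (- x) = - l x.
Proof. by rewrite -scaleN1r is_scalarZ mulN1r. Qed.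

Lemma is_scalarB x y : l (x - y) = l x - l y.
Proof. by rewrite is_scalarD is_scalarN. Qed.

End scalar_theory.

(** * Sublinear functionals and the Hahn-Banach theorem *)

Definition sublinear (R : realType) (V : lmodType R) (p : V -> R) : Prop :=
  (forall x y, p (x + y) <= p x + p y) /\
  (forall (t : R) x, 0 <= t -> p (t *: x) <= t * p x).

(** Every sublinear functional below is an infimum of this form; the hypotheses
    say that the values a in S x are, up to decreasing them, compatible with
    addition and scaling.  The bound at 0 alone makes all infima finite, since
    adding an element of S (- x) to one of S x leads to S 0. *)
Lemma sublinear_inf (R : realType) (V : lmodType R) (S : V -> set R) :
  (forall x, S x !=set0) ->
  (forall x y a b, S x a -> S y b -> exists2 c, S (x + y) c & c <= a + b) ->
  (forall (t : R) x a, 0 <= t -> S x a -> exists2 c, S (t *: x) c & c <= t * a) ->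
  (forall c, S 0 c -> 0 <= c) ->
  (forall x a, S x a -> inf (S x) <= a) /\ sublinear (fun x => inf (S x)).
Proof.
move=> S0 SD SZ S_ge0.
have hinf x : has_inf (S x).
  split=> //; have [b Sb] := S0 (- x); exists (- b) => a Sa.
  have [c] := SD _ _ _ _ Sa Sb; rewrite subrr => /S_ge0; lra.
have lbS x a : S x a -> inf (S x) <= a.
  by move=> Sa; apply: ge_inf => //; case: (hinf x).
split=> //; split=> [x y|t x t0].
  rewrite -lerBlDr; apply: lb_le_inf => // a Sa.
  rewrite lerBlDr -lerBlDl; apply: lb_le_inf => // b Sb.
  by have [c Sc cab] := SD _ _ _ _ Sa Sb; have := lbS _ _ Sc; lra.
have [t_gt0|t_le0] := ltP 0 t; last first.
  have -> : t = 0 by apply/eqP; rewrite eq_le t_le0.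
  have [a Sa] := S0 x; have [c Sc] := SZ 0 x a (lexx 0) Sa.
  by rewrite !mul0r => c0; apply: le_trans (lbS _ _ Sc) c0.
rewrite -ler_pdivrMl//; apply: lb_le_inf => // a Sa.
rewrite ler_pdivrMl//; have [c Sc ca] := SZ t x a t0 Sa.
exact: le_trans (lbS _ _ Sc) ca.
Qed.

Lemma sublinear0 (R : realType) (V : lmodType R) (p : V -> R) :
  sublinear p -> p 0 = 0.
Proof.
move=> [pD pZ]; have := pD 0 0; have := pZ 0 0 (lexx 0).
by rewrite addr0 scale0r mul0r; lra.
Qed.

Lemma sublinear_scale_ge (R : realType) (V : lmodType R) (p : V -> R) (t : R) v :
  sublinear p -> 0 <= t -> t * p v <= p (t *: v).
Proof.
move=> sp; rewrite le_eqVlt => /predU1P[<-|t0].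
  by rewrite scale0r mul0r sublinear0.
have := sp.2 t^-1 (t *: v); rewrite invr_ge0 => /(_ (ltW t0)).
by rewrite scalerA mulVf ?gt_eqF// scale1r ler_pdivlMl.
Qed.

(** For each v the functional x |-> inf over t >= 0 of p (x + t v) - t p v is
    sublinear and at most p, so it equals p by minimality; its term t = 1 gives
    p x + p v <= p (x + v), the inequality that p lacks to be additive. *)
Lemma minimal_sublinear_scalar (R : realType) (V : lmodType R) (p : V -> R) :
  sublinear p ->
  (forall q, sublinear q -> (forall x, q x <= p x) -> q = p) ->
  scalar p.
Proof.
move=> sp minp; have [pD pZ] := sp.
have p0 := sublinear0 sp.
have superD x v : p x + p v <= p (x + v).
  pose S x := [set p (x + t *: v) - t * p v | t in [set t : R | 0 <= t]].
  have [||||lbS sS] := @sublinear_inf _ _ S.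
  - by move=> y; exists (p (y + 0 *: v) - 0 * p v), 0 => /=.
  - move=> y z _ _ [t t0 <-] [u u0 <-].
    exists (p (y + z + (t + u) *: v) - (t + u) * p v).
      by exists (t + u) => //=; exact: addr_ge0.
    by have := pD (y + t *: v) (z + u *: v); rewrite scalerDl addrACA; lra.
  - move=> t y _ t0 [u u0 <-].
    exists (p (t *: y + (t * u) *: v) - (t * u) * p v).
      by exists (t * u) => //=; exact: mulr_ge0.
    by have := pZ t (y + u *: v) t0; rewrite scalerDr scalerA; lra.
  - move=> _ [t t0 <-]; rewrite add0r subr_ge0.
    exact: sublinear_scale_ge.
  have -> : p x = inf (S x).
    rewrite -[in LHS](minp _ sS)// => y; apply: lbS.
    by exists 0 => //=; rewrite scale0r addr0 mul0r subr0.
  have : S x (p (x + v) - p v) by exists 1 => //=; rewrite scale1r mul1r.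
  by move=> /lbS; lra.
have padd x y : p (x + y) = p x + p y.
  by apply/eqP; rewrite eq_le pD superD.
have pN x : p (- x) = - p x.
  by have := padd x (- x); rewrite subrr p0; lra.
have pZp t x : 0 <= t -> p (t *: x) = t * p x.
  by move=> t0; apply/eqP; rewrite eq_le pZ// sublinear_scale_ge.
move=> t x y; rewrite padd; congr (_ + _).
have [t0|t0] := leP 0 t; first by rewrite pZp.
have tN : 0 <= - t by rewrite oppr_ge0 ltW.
by have := pZp _ x tN; rewrite scaleNr pN; lra.
Qed.

(** A chain of sublinear functionals below q has its pointwise infimum as a lower
    bound, so Zorn's lemma provides a minimal one, which is linear.  Working
    with functionals defined everywhere avoids partial extensions. *)
Lemma Hahn_Banach (R : realType) (V : lmodType R) (q : V -> R) :
  sublinear q -> exists2 l : V -> R, scalar l & forall x, l x <= q x.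
Proof.
move=> sq.
pose T := {p : V -> R | sublinear p /\ forall x, p x <= q x}.
pose r (p1 p2 : T) := `[< forall x, sval p2 x <= sval p1 x >].
have [||||p maxp] := @Zorn T r.
- by move=> p; apply/asboolP.
- move=> p1 p2 p3 /asboolP h12 /asboolP h23; apply/asboolP => x.
  exact: le_trans (h23 x) (h12 x).
- move=> [p1 h1] [p2 h2] /asboolP /= h12 /asboolP /= h21.
  apply: eq_exist; apply/funext => x; apply/eqP.
  by rewrite eq_le h12 h21.
- move=> A Atot.
  have [A0|/set0P[p0 Ap0]] := eqVneq A set0.
    by exists (exist _ q (conj sq (fun x => lexx (q x)))) => s; rewrite A0.
  pose S x := [set sval p x | p in A].
  have [||||lbS sS] := @sublinear_inf _ _ S.
  + by move=> x; exists (sval p0 x), p0.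
  + move=> x y _ _ [p1 A1 <-] [p2 A2 <-].
    have [/asboolP h|/asboolP h] := Atot _ _ A1 A2.
    * exists (sval p2 (x + y)); first by exists p2.
      by have := (svalP p2).1.1 x y; have := h x; lra.
    * exists (sval p1 (x + y)); first by exists p1.
      by have := (svalP p1).1.1 x y; have := h y; lra.
  + move=> t x _ t0 [p1 A1 <-]; exists (sval p1 (t *: x)); first by exists p1.
    exact: (svalP p1).1.2.
  + by move=> _ [p1 A1 <-]; rewrite (sublinear0 (svalP p1).1).
  have Sq x : inf (S x) <= q x.
    by apply: le_trans ((svalP p0).2 x); apply: lbS; exists p0.
  exists (exist _ (fun x => inf (S x)) (conj sS Sq)) => s As; apply/asboolP => x /=.
  by apply: lbS; exists s.
exists (sval p); last exact: (svalP p).2.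
apply: minimal_sublinear_scalar; first exact: (svalP p).1.
move=> q' sq' q'p.
have h x : q' x <= q x by apply: le_trans (q'p x) ((svalP p).2 x).
have := maxp (exist _ q' (conj sq' h)).
by move=> /(_ (asboolT q'p)) <-.
Qed.

(** * Separating a convex function from a linear one *)

Lemma convex_setP (R : realType) (V : lmodType R) (A : set V) : 
  convex_set A <-> forall (s t : R) x y, 0 <= s -> 0 <= t -> s + t = 1 ->
    A x -> A y -> A (s *: x + t *: y).
Proof.
split=> [cA s t x y s0 t0 st1 Ax Ay|cA x y l /set_mem Ax /set_mem Ay].
  have s1 : s <= 1 by rewrite -st1 lerDl.
  have -> : t = 1 - s by rewrite -st1 addrC addKr.
  exact/set_mem/(cA x y (Itv01 s0 s1) (mem_set Ax) (mem_set Ay)).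
apply/mem_set/cA => //; first by rewrite subr_ge0.
by rewrite addrC subrK.
Qed.

Lemma cone_hullD (R : realType) (V : lmodType R) (D : set V) x y :
  convex_set D -> cone_hull D x -> cone_hull D y -> cone_hull D (x + y).
Proof.
move=> /convex_setP cD [s s0 [d Dd <-]] [t t0 [e De <-]]; rewrite /= in s0 t0.
have [st0|st0] := eqVneq (s + t) 0.
  have [s_0 t_0] : s = 0 /\ t = 0 by split; lra.
  by exists 0 => //=; exists d => //; rewrite s_0 t_0 !scale0r addr0.
have st : 0 < s + t by rewrite lt_neqAle eq_sym st0 addr_ge0.
exists (s + t); first exact: ltW.
exists ((s / (s + t)) *: d + (t / (s + t)) *: e).
  apply: cD => //; try by rewrite divr_ge0// ltW.
  by rewrite -mulrDl divff.
by rewrite scalerDr !scalerA ![(s + t) * _]mulrC !divfK.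
Qed.

(** Convexity with two explicit weights, which suits the weights s / (s + t) of
    the sandwich theorem better than elements of the unit interval type. *)
Definition convex_fun (R : realType) (V : lmodType R) (g : V -> R) : Prop :=
  forall (s t : R) x y, 0 <= s -> 0 <= t -> s + t = 1 ->
    g (s *: x + t *: y) <= s * g x + t * g y.

(** A linear l satisfies both conclusions exactly when it lies below
      q v = inf over t > 0 and e in E of g (t (v + e)) / t - h e.
    Convexity of g makes q sublinear: the terms for (t, d) and (u, e) combine
    into the one for d + e and the harmonic parameter s = (1/t + 1/u)^-1.
    Its finiteness amounts to q 0 >= 0, which is the inequality h <= g on the
    cone E. *)
Lemma sandwich_cone (R : realType) (V : lmodType R) (g h : V -> R) (E : set V) :
  convex_fun g -> g 0 = 0 -> scalar h ->
  E 0 -> (forall x y, E x -> E y -> E (x + y)) ->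
  (forall (t : R) x, 0 <= t -> E x -> E (t *: x)) ->
  (forall e, E e -> h e <= g e) ->
  exists l : V -> R,
    [/\ scalar l, forall v, l v <= g v & forall e, E e -> h e <= l e].
Proof.
move=> cg g0 hlin E0 ED EZ hg.
have h0 := is_scalar0 hlin.
pose S v := [set a | exists t e,
  [/\ 0 < t, E e & a = t^-1 * g (t *: (v + e)) - h e]].
have [||||lbS sS] := @sublinear_inf _ _ S.
- by move=> v; exists (1^-1 * g (1 *: (v + 0)) - h 0), 1, 0; split.
- move=> x y _ _ [t [d [t0 Ed ->]]] [u [e [u0 Ee ->]]].
  pose s := (t^-1 + u^-1)^-1.
  have s0 : 0 < s by rewrite invr_gt0 addr_gt0 ?invr_gt0.
  exists (s^-1 * g (s *: (x + y + (d + e))) - h (d + e)).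
    by exists s, (d + e); split=> //; exact: ED.
  have st : 0 <= s / t by rewrite divr_ge0 ?ltW.
  have su : 0 <= s / u by rewrite divr_ge0 ?ltW.
  have s1 : s / t + s / u = 1 by rewrite -mulrDr mulVf// gt_eqF// -invr_gt0.
  have := cg _ _ (t *: (x + d)) (u *: (y + e)) st su s1.
  rewrite !scalerA !divfK ?gt_eqF// -scalerDr addrACA => gle.
  have : s^-1 * g (s *: (x + y + (d + e))) <=
      t^-1 * g (t *: (x + d)) + u^-1 * g (u *: (y + e)).
    by rewrite ler_pdivrMl// mulrDr !mulrA.
  by rewrite (is_scalarD hlin); lra.
- move=> t x _ t0 [u [e [u0 Ee ->]]].
  have [t_gt0|t_le0] := ltP 0 t.
    exists ((u / t)^-1 * g ((u / t) *: (t *: x + t *: e)) - h (t *: e)).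
      by exists (u / t), (t *: e); split; [exact: divr_gt0|exact: EZ|].
    rewrite -scalerDr scalerA divfK ?gt_eqF// (is_scalarZ hlin) invf_div.
    by rewrite mulrBr mulrA.
  have -> : t = 0 by apply/eqP; rewrite eq_le t_le0.
  exists 0; last by rewrite mul0r.
  exists 1, 0; split=> //.
  by rewrite scale0r addr0 scaler0 g0 h0 mulr0 subr0.
- move=> _ [t [e [t0 Ee ->]]]; rewrite add0r subr_ge0 ler_pdivlMl// -(is_scalarZ hlin).
  by apply: hg; apply: EZ => //; exact: ltW.
have [l llin lS] := Hahn_Banach sS; exists l; split=> //.
- move=> v; apply: le_trans (lS v) _; apply: lbS.
  by exists 1, 0; split=> //; rewrite addr0 scale1r invr1 mul1r h0 subr0.
- move=> e Ee.
  have : l (- e) <= - h e.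
    apply: le_trans (lS _) _; apply: lbS.
    by exists 1, e; split=> //; rewrite addNr scaler0 g0 mulr0 sub0r.
  by rewrite (is_scalarN llin) lerN2.
Qed.

(** On the cone generated by D the inequality h <= g persists: below d it holds
    because D is convex and contains 0, beyond d because g is convex with
    g 0 = 0. *)
Lemma sandwich_convex (R : realType) (V : lmodType R) (g h : V -> R) (D : set V) :
  convex_fun g -> g 0 = 0 -> scalar h -> convex_set D -> D 0 ->
  (forall d, D d -> h d <= g d) ->
  exists l : V -> R,
    [/\ scalar l, forall v, l v <= g v & forall d, D d -> h d <= l d].
Proof.
move=> cg g0 lh cD D0 hg.
have [||||l [ll lg hl]] := @sandwich_cone R V g h (cone_hull D) cg g0 lh.
- by exists 0 => //=; exists 0 => //; rewrite scale0r.
- by move=> x y; exact: cone_hullD.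
- move=> t _ t0 [s s0 [d Dd <-]]; exists (t * s); first exact: mulr_ge0.
  by exists d => //; rewrite scalerA.
- move=> _ [s s0 [d Dd <-]]; rewrite /= in s0.
  have [s1|s1] := leP s 1.
    apply: hg; have := (convex_setP D).1 cD s (1 - s) d 0 s0.
    by rewrite subr_ge0 s1 subrKC scaler0 addr0; apply.
  rewrite (is_scalarZ lh) -ler_pdivlMl ?(lt_trans ltr01)//.
  apply: le_trans (hg _ Dd) _.
  have sV : 0 <= s^-1 by rewrite invr_ge0.
  have sV1 : 0 <= 1 - s^-1 by rewrite subr_ge0 invf_le1 ?ltW// (lt_trans ltr01).
  have := cg _ _ (s *: d) 0 sV sV1 (subrKC _ _).
  rewrite g0 mulr0 scaler0 !addr0 scalerA.
  by rewrite mulVf ?gt_eqF ?(lt_trans ltr01)// scale1r.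
exists l; split=> // d Dd; apply: hl; exists 1 => //=.
by exists d => //; rewrite scale1r.
Qed.

(** * The topological dual *)

Section duals.
Context {R : realType}.

Lemma dual_bounded (V : normedModType R) (l : V -> R) :
  dual_space l -> exists2 c, 0 <= c & forall v, `|l v| <= c * `|v|.
Proof.
move=> [ll lc].
pose L : {linear V -> R^o} := HB.pack l (GRing.isLinear.Build _ _ _ _ l ll).
have /linear_boundedP : bounded_near L (nbhs 0).
  exact/linear_bounded_continuous.
move=> [c [creal hc]]; exists (`|c| + 1) => [|v]; first exact: addr_ge0.
by apply: hc; rewrite (le_lt_trans (ler_norm c))// ltrDl.
Qed.

(** A one-sided bound suffices since l (- v) = - l v. *)
Lemma scalar_bounded_above_dual (V : normedModType R) (l : V -> R) (M : R) :
  scalar l -> (\forall v \near 0, l v <= M) -> dual_space l.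
Proof.
move=> ll lM; split=> //.
pose L : {linear V -> R^o} := HB.pack l (GRing.isLinear.Build _ _ _ _ l ll).
apply: (@bounded_linear_continuous _ _ _ L).
exists M; split; first exact: num_real.
move=> N MN; have lMN : \forall v \near (0 : V), l (- v) <= M.
  have to0 : - v @[v --> (0 : V)] --> (0 : V).
    by rewrite -[X in _ --> X]oppr0; apply: cvgN; exact: cvg_id.
  exact: (to0 _ lM).
near=> v => /=; apply: le_trans (ltW MN); rewrite ler_norml.
have : l v <= M by near: v.
have : l (- v) <= M by near: v.
by rewrite (is_scalarN ll); lra.
Unshelve. all: by end_near. Qed.

Lemma dualD (V : normedModType R) (l m : V -> R) :
  dual_space l -> dual_space m -> dual_space (l \+ m).
Proof.
move=> [ll lc] [ml mc]; split=> [t x y|x].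
  by rewrite /= ll ml; lra.
by apply: (@cvgD _ R^o); [exact: lc|exact: mc].
Qed.

Lemma dualN (V : normedModType R) (l : V -> R) : dual_space l -> dual_space (\- l).
Proof.
move=> [ll lc]; split=> [t x y|x]; first by rewrite /= ll; lra.
by apply: (@cvgN _ R^o); exact: lc.
Qed.

Lemma dual_comp (U V : normedModType R) (l : V -> R) (a : U -> V) :
  linear a -> continuous a -> dual_space l -> dual_space (l \o a).
Proof.
move=> al ac [ll lc]; split=> [t x y|x]; first by rewrite /= al ll.
by apply: continuous_comp; [exact: ac|exact: lc].
Qed.

Lemma dual_dpair (U V : normedModType R) (us : U -> R) (vs : V -> R) :
  dual_space us -> dual_space vs -> dual_space (Defs.dpair us vs).
Proof.
move=> du dv.
apply: (@dualD _ (us \o fst) (vs \o snd)); apply: dual_comp => //.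
- by move=> x; exact: cvg_fst.
- by move=> x; exact: cvg_snd.
Qed.

Lemma dual_inl (U V : normedModType R) (l : U * V -> R) :
  dual_space l -> dual_space (fun u => l (u, 0)).
Proof.
apply: (@dual_comp _ _ l (fun u => (u, 0))) => [t x y|x].
  by congr pair; rewrite /= scaler0 addr0.
by apply: cvg_pair; [exact: cvg_id|exact: cvg_cst].
Qed.

Lemma dual_inr (U V : normedModType R) (l : U * V -> R) :
  dual_space l -> dual_space (fun v => l (0, v)).
Proof.
apply: (@dual_comp _ _ l (fun v => (0, v))) => [t x y|x].
  by congr pair; rewrite /= scaler0 addr0.
by apply: cvg_pair; [exact: cvg_cst|exact: cvg_id].
Qed.

Lemma dpair_inl_inr (U V : normedModType R) (l : U * V -> R) : scalar l ->
  Defs.dpair (fun u => l (u, 0)) (fun v => l (0, v)) = l.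
Proof.
move=> ll; apply/funext => -[u v]; rewrite /Defs.dpair /= -(is_scalarD ll).
by congr l; congr pair; rewrite /= ?addr0 ?add0r.
Qed.

End duals.

(** * Bounded selections of closed convex multifunctions *)

(** The Robinson-Ursescu argument.  Let A M be the set of the w that admit some y
    with |y| <= M and G (w, y).  By Baire's theorem the closure of some A n has an
    interior point w1; averaging with the reflection 2 w0 - w1 of w1 through w0
    shows that, for some N, every point near w0 is approximated by points of A N.
    Approximating again the doubled error, and so on, writes w0 + e / 2 as
    the convex series of 2^-(k+1) a_k with a_k in A N; the series of the
    corresponding y_k converges by completeness of Y, and its sum is admissible
    since G is closed and convex. *)
Lemma locally_bounded_selection (R : realType) (W Y : completeNormedModType R)
    (G : set (W * Y)) (w0 : W) :
  closed G -> convex_set G -> (forall w, exists y, G (w, y)) ->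
  exists M, \forall w \near w0, exists2 y, `|y| <= M & G (w, y).
Proof.
move=> Gcl /convex_setP Gcv Gtot.
pose A (M : R) := [set w | exists2 y, `|y| <= M & G (w, y)].
have A_mono (M N : R) w : M <= N -> A M w -> A N w.
  by move=> MN [y yM Gy]; exists y => //; exact: le_trans yM MN.
have A_conv M s t w v : 0 <= s -> 0 <= t -> s + t = 1 -> A M w -> A M v ->
    A M (s *: w + t *: v).
  move=> s0 t0 st [y yM Gy] [z zM Gz]; exists (s *: y + t *: z).
    apply: le_trans (ler_normD _ _) _; rewrite !normrZ !ger0_norm//.
    rewrite -[leRHS]mul1r -st mulrDl lerD// ler_wpM2l//.
  exact: (Gcv s t (w, y) (v, z)).
(* Otherwise the complements of the closures would be open and dense. *)
have [n [w1 [r r0 Hball]]] : exists (n : nat) w1, exists2 r : R, 0 < r &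
    ball w1 r `<=` closure (A n%:R).
  apply: contrapT => hno.
  have dns : dense (\bigcap_n ~` closure (A n%:R)).
    apply: Baire => i; split; first exact/closed_openC/closed_closure.
    apply: contrapT => /denseNE [B [[x /open_nbhs_nbhs Bx]]].
    move=> /disjoints_subset; rewrite setCK => BA.
    have /nbhs_ballP[r r0 br] := Bx.
    by apply: hno; exists i, x, r => // z /br /BA.
  have [w [_ hw]] : [set: W] `&` (\bigcap_n ~` closure (A n%:R)) !=set0.
    by apply: dns; [exists w0|exact: openT].
  have [y Gy] := Gtot w.
  apply: (hw (Num.truncn `|y|).+1 I); apply: subset_closure.
  by exists y => //; rewrite ltW// truncnS_gt.
have [y2 Gy2] := Gtot (2 *: w0 - w1).
have half1 : 2^-1 + 2^-1 = 1 :> R by rewrite [RHS](splitr 1) !div1r.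
pose N := Num.max n%:R `|y2|.
have A2 : A N (2 *: w0 - w1) by exists y2 => //; rewrite le_max lexx orbT.
pose d := r / 2.
have d0 : 0 < d by rewrite divr_gt0.
have approx e : `|e| < d -> exists2 a, A N a & `|w0 + e - a| < d / 2.
  move=> ed.
  have hb : ball w1 r (w1 + 2 *: e).
    rewrite -ball_normE /ball_ /= opprD addNKr normrN normrZ ger0_norm//.
    by rewrite -ltr_pdivlMl// mulrC.
  have [a [/(A_mono _ N)Aa]] := Hball _ hb _ (nbhsx_ballx _ d d0).
  rewrite -ball_normE /ball_ /= => ba.
  exists (2^-1 *: a + 2^-1 *: (2 *: w0 - w1)).
    apply: A_conv; rewrite ?invr_ge0//.
    by apply: Aa; rewrite le_max lexx.
  have -> : w0 + e - (2^-1 *: a + 2^-1 *: (2 *: w0 - w1)) =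
      2^-1 *: (w1 + 2 *: e - a).
    rewrite !scalerBr scalerDr !scalerA mulVf// !scale1r.
    by apply/eqP; rewrite subr_eq addrA subrK [eqbRHS]addrC addrA subrK.
  by rewrite normrZ ger0_norm ?invr_ge0// mulrC ltr_pM2r// invr_gt0.
have /choice[ay hay] : forall e, exists ay : W * Y, `|e| < d ->
    [/\ G ay, `|ay.2| <= N & `|w0 + e - ay.1| < d / 2].
  move=> e.
  have [/approx[a [y yN Gy] ae]|] := pselect (`|e| < d); first by exists (a, y).
  by exists (w0, 0).
have [y0 Gy0] := Gtot w0.
have N0 : 0 <= N by rewrite le_max ler0n.
have half e : `|e| < d -> A N (w0 + 2^-1 *: e).
  move=> ed.
  pose es k := iter k (fun e => 2 *: (w0 + e - (ay e).1)) e.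
  have esd k : `|es k| < d.
    elim: k => //= k IH; rewrite normrZ ger0_norm// -ltr_pdivlMl// mulrC.
    by have [] := hay _ IH.
  pose c k : R := 2^-1 ^+ k.
  have c_ge0 k : 0 <= c k by rewrite exprn_ge0// invr_ge0.
  have cS k : c k = c k.+1 + c k.+1.
    by rewrite /c exprS -mulrDl half1 mul1r.
  pose x := series (fun k => c k.+1 *: (ay (es k)).1).
  pose y := series (fun k => c k.+1 *: (ay (es k)).2).
  (* The remaining weight c k = 2^-k of the series is put on an arbitrary point
     of G, so that the partial sums become genuine convex combinations. *)
  have Gxy k u v : G (u, v) -> G (x k + c k *: u, y k + c k *: v).
    elim: k u v => [|k IH] u v Guv.
      by rewrite /x /y /series/= !big_geq// !add0r /c expr0 !scale1r.
    have [G1 _ _] := hay _ (esd k).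
    rewrite /x /y !seriesSr.
    have v0 : 0 <= 2^-1 :> R by rewrite invr_ge0.
    have /IH := Gcv _ _ (ay (es k)) (u, v) v0 v0 half1 G1 Guv.
    by rewrite !scalerDr !scalerA -!exprSr !addrA.
  (* The recursion es k.+1 = 2 (w0 + es k - a_k) makes the sum telescope. *)
  have xE k : x k + c k *: w0 = w0 + 2^-1 *: e - c k.+1 *: es k.
    apply/eqP; rewrite -subr_eq opprK; apply/eqP.
    elim: k => [|k <-].
      by rewrite /x /series/= big_geq// add0r /c expr0 scale1r expr1.
    rewrite /x seriesSr -/x /= scalerA /c [_ ^+ k.+2]exprSr mulfVK// -/(c _).
    rewrite -/(c k) [c k]cS scalerDl -!addrA -!scalerDr; congr (_ + _ *: _).
    by rewrite [LHS]addrC -!addrA addNr addr0.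
  have c_cvg0 : c @ \oo --> (0 : R).
    rewrite [c](_ : _ = geometric 1 2^-1) ?funeqE ?mul1r//; last first.
      by move=> k; rewrite /= mul1r.
    by apply: cvg_geometric; rewrite ger0_norm ?invr_ge0// invf_lt1// ltr1n.
  have x_cvg : x k + c k *: w0 @[k --> \oo] --> w0 + 2^-1 *: e.
    rewrite (funext xE) -[X in _ --> X]subr0; apply: cvgB; first exact: cvg_cst.
    apply/norm_cvg0P; apply: (@squeeze_cvgr _ _ _ _ (cst 0) (fun k => c k * d)).
    - near=> k; rewrite normr_ge0 normrZ ger0_norm// ler_pM//; last exact: ltW.
      by rewrite [c k]cS lerDl.
    - exact: cvg_cst.
    - by rewrite -(mul0r d); apply: cvgMr_tmp.
  have y_term k : `|c k.+1 *: (ay (es k)).2| <= c k.+1 * N.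
    by rewrite normrZ ger0_norm// ler_wpM2l//; have [] := hay _ (esd k).
  have ycvg : cvgn y.
    apply: normed_cvg; apply: (series_le_cvg _ _ y_term).
    - by move=> k; exact: normr_ge0.
    - by move=> k; exact: mulr_ge0.
    rewrite (_ : (fun k => c k.+1 * N) = geometric (2^-1 * N) 2^-1).
      apply: is_cvg_geometric_series.
      by rewrite ger0_norm ?invr_ge0// invf_lt1// ltr1n.
    by apply/funext => k; rewrite /c exprS /= mulrAC.
  have y_le k : `|y k| <= (1 - c k) * N.
    elim: k => [|k IH].
      by rewrite /y /series/= big_geq// normr0 /c expr0 subrr mul0r.
    rewrite {1}/y seriesSr; apply: le_trans (ler_normD _ _) _.
    apply: le_trans (lerD IH (y_term k)) _.
    by rewrite [c k]cS; lra.
  exists (limn y).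
    rewrite -lim_norm//; apply: limr_le; first exact: is_cvg_norm.
    near=> k; apply: le_trans (y_le k) _.
    by rewrite -[leRHS]mul1r ler_wpM2r// lerBlDr lerDl.
  have GF : \forall k \near \oo, G (x k + c k *: w0, y k + c k *: y0).
    by near=> k; exact: Gxy.
  apply: (closed_cvg G Gcl GF).
  apply: cvg_pair => //=.
  rewrite -[limn y]addr0; apply: cvgD => //.
  by rewrite -(scale0r y0); apply: cvgZr_tmp.
exists N; near=> w.
have -> : w = w0 + 2^-1 *: (2 *: (w - w0)).
  by rewrite scalerA mulVf// scale1r addrC subrK.
apply: half; rewrite normrZ ger0_norm// -ltr_pdivlMl// distrC.
by near: w; apply: cvgr_dist_lt => //; rewrite mulr_gt0// invr_gt0.
Unshelve. all: by end_near.
Qed.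

(** Each w = (u, v) is the midpoint of (2 u - u0, v0) and (u0, 2 v - v0), so it is
    enough to select along the two slices through w0; this reduces the product
    of two Banach spaces to each of its factors. *)
Lemma locally_bounded_selection_prod (R : realType)
    (U V Y : completeNormedModType R) (G : set (U * V * Y)) (w0 : U * V) :
  closed G -> convex_set G -> (forall w, exists y, G (w, y)) ->
  exists M, \forall w \near w0, exists2 y, `|y| <= M & G (w, y).
Proof.
case: w0 => u0 v0 Gcl /convex_setP Gcv Gtot.
have half1 : 2^-1 + 2^-1 = 1 :> R by rewrite [RHS](splitr 1) !div1r.
have half0 : 0 <= 2^-1 :> R by rewrite invr_ge0.
have cl1 : closed [set z : U * Y | G ((z.1, v0), z.2)].
  have fc : continuous (fun z : U * Y => ((z.1, v0), z.2)).
    move=> z; apply: (@cvg_pair _ _ _ _ (nbhs (_, _))) => /=; last exact: cvg_snd.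
    by apply: cvg_pair; [exact: cvg_fst|exact: cvg_cst].
  by apply: (preimage_closed _ Gcl) => z _; exact: fc.
have cl2 : closed [set z : V * Y | G ((u0, z.1), z.2)].
  have fc : continuous (fun z : V * Y => ((u0, z.1), z.2)).
    move=> z; apply: (@cvg_pair _ _ _ _ (nbhs (_, _))) => /=; last exact: cvg_snd.
    by apply: cvg_pair; [exact: cvg_cst|exact: cvg_fst].
  by apply: (preimage_closed _ Gcl) => z _; exact: fc.
have cv1 : convex_set [set z : U * Y | G ((z.1, v0), z.2)].
  apply/convex_setP => s t x y s0 t0 st Gx Gy /=.
  have := Gcv _ _ _ _ s0 t0 st Gx Gy.
  by congr (G (pair (pair _ _) _)); rewrite /= -scalerDl st scale1r.
have cv2 : convex_set [set z : V * Y | G ((u0, z.1), z.2)].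
  apply/convex_setP => s t x y s0 t0 st Gx Gy /=.
  have := Gcv _ _ _ _ s0 t0 st Gx Gy.
  by congr (G (pair (pair _ _) _)); rewrite /= -scalerDl st scale1r.
have [M1 n1] := locally_bounded_selection u0 cl1 cv1 (fun u => Gtot (u, v0)).
have [M2 n2] := locally_bounded_selection v0 cl2 cv2 (fun v => Gtot (u0, v)).
have refl (W : completeNormedModType R) (a : W) (Q : set W) :
    nbhs a Q -> \forall w \near a, Q (2 *: w - a).
  move=> Qa; have : 2 *: w - a @[w --> a] --> a.
    rewrite [X in _ --> X](_ : _ = 2 *: a - a).
      by apply: cvgB; [apply: cvgZl_tmp; exact: cvg_id|exact: cvg_cst].
    by rewrite scaler_nat mulr2n addrK.
  by move=> /(_ _ Qa).
have mid (W : completeNormedModType R) (a w : W) :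
    w = 2^-1 *: (2 *: w - a) + 2^-1 *: a.
  by rewrite -scalerDr subrK scalerA mulVf// scale1r.
exists (Num.max M1 M2).
exists ([set u | exists2 y, `|y| <= M1 & G ((2 *: u - u0, v0), y)],
        [set v | exists2 y, `|y| <= M2 & G ((u0, 2 *: v - v0), y)]).
  by split; [exact: refl n1|exact: refl n2].
move=> [u v] [/= [y yM Gy] [z zM Gz]].
exists (2^-1 *: y + 2^-1 *: z).
  apply: le_trans (ler_normD _ _) _; rewrite !normrZ !ger0_norm//.
  have -> : Num.max M1 M2 = 2^-1 * Num.max M1 M2 + 2^-1 * Num.max M1 M2.
    by rewrite -mulrDl half1 mul1r.
  by apply: lerD; apply: ler_wpM2l => //; rewrite le_max ?yM ?zM ?orbT.
have := Gcv _ _ _ _ half0 half0 half1 Gy Gz.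
congr (G (pair (pair _ _) _)) => /=; first by rewrite -mid.
by rewrite addrC -mid.
Qed.

(** * Normal cones and subdifferentials *)

(** The quotient defining Frechet normals is constant along the segment from w0
    to w, which stays in B and enters A near w0: if it were positive, the upper
    limit would be too. *)
Lemma frechet_normal_cone_locally_convex (R : realType) (U V : normedModType R)
    (w0 : U * V) (A B : set (U * V)) :
  convex_set B -> B w0 -> A `<=` B -> (\forall w \near w0, B w -> A w) ->
  frechet_normal_cone w0 A = normal_cone w0 B.
Proof.
move=> /convex_setP cB B0 AB nBA; apply/seteqP; split => ws [dws Hws]; split=> //.
  move=> w Bw; rewrite leNgt; apply/negP => c0; have [lws _] := dws.
  set d := w - w0 in c0 *.
  have d0 : d != 0 by apply: contraTneq c0 => ->; rewrite (is_scalar0 lws) ltxx.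
  have s0 : 0 < sumnorm d.
    rewrite /sumnorm lt_neqAle addr_ge0// andbT eq_sym paddr_eq0// !normr_eq0.
    apply: contra d0 => /andP[/eqP d1 /eqP d2].
    by rewrite [d]surjective_pairing d1 d2.
  have /ereal_inf_lt : (limf_esup
      (fun w : U * V => (ws (w - w0) / sumnorm (w - w0))%:E) (within A w0^') < (ws d / sumnorm d)%:E)%E.
    by apply: le_lt_trans Hws _; rewrite lte_fin divr_gt0.
  move=> [_ [S wS <-] Sd].
  have nS : \forall w \near w0, B w -> w != w0 -> S w.
    have wS' : \forall w \near w0, w != w0 -> A w -> S w by exact: wS.
    by apply: filterS2 nBA wS' => z BA AS Bz z0; apply: AS => //; exact: BA.
  have path : t *: d + w0 @[t --> (0 : R)^'+] --> w0.
    rewrite -[X in _ --> X]add0r -[X in _ --> X + _](scale0r d).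
    apply: cvgD; last exact: cvg_cst.
    by apply: cvgZr_tmp; apply: cvg_at_right_filter; exact: cvg_id.
  have [t [t0 t1 St]] : exists t : R, [/\ 0 < t, t <= 1 &
      B (t *: d + w0) -> t *: d + w0 != w0 -> S (t *: d + w0)].
    near (0 : R)^'+ => t; exists t; split; near: t.
    - exact: nbhs_right_gt.
    - by apply: nbhs_right_le.
    - exact: path _ nS.
  have Bt : B (t *: d + w0).
    have := cB t (1 - t) w w0 (ltW t0).
    rewrite subr_ge0 addrC subrK => /(_ t1 erefl Bw B0).
    congr B; rewrite /d scalerBr scalerBl scale1r -[RHS]addrA.
    by congr (_ + _); rewrite addrC.
  have td0 : t *: d + w0 != w0.
    by rewrite -subr_eq0 addrK scaler_eq0 negb_or gt_eqF.
  have : ((ws d / sumnorm d)%:E <= ereal_sup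
      [set ((ws (w - w0) / sumnorm (w - w0))%:E)%E | w in S])%E.
    apply: ereal_sup_ubound; exists (t *: d + w0); first exact: St.
    rewrite addrK (is_scalarZ lws); congr EFin.
    have -> : sumnorm (t *: d) = t * sumnorm d.
      by rewrite /sumnorm /= !normrZ gtr0_norm// mulrDr.
    by rewrite -mulf_div divff ?gt_eqF// mul1r.
  by move=> /(lt_le_trans Sd); rewrite ltxx.
rewrite limf_esupE; apply: ge_ereal_inf.
exists (ereal_sup [set ((ws (w - w0) / sumnorm (w - w0))%:E)%E | w in A]).
  by exists A => //; exact: withinT.
apply: ge_ereal_sup => _ [w Aw <-]; rewrite lee_fin.
apply: mulr_le0_ge0; first by apply: Hws; exact: AB.
by rewrite invr_ge0 addr_ge0.
Unshelve. all: by end_near.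
Qed.

(** The difference quotient t^-1 (phi (w0 + t v) - phi w0) tends to the
    directional derivative as t decreases to 0.  It is bounded below by z v for
    each subgradient z, whence z = phi' (w0) using v and - v; and by convexity it
    is at most phi (w0 + v) - phi w0 for t <= 1, so phi' (w0) is a subgradient. *)
Lemma subdifferential_diff (R : realType) (W Y : normedModType R)
    (f : W -> Y) (ys : Y -> R) (w0 : W) :
  convex_fun (ys \o f) -> dual_space ys -> differentiable f w0 ->
  subdifferential (ys \o f) w0 = [set ys \o 'd f w0].
Proof.
move=> cphi dys df; have [lys cys] := dys.
have dual_d : dual_space (ys \o 'd f w0).
  by apply: dual_comp => //; [exact: linearP|exact: diff_continuous].
have quot v : t^-1 * (ys (f (t *: v + w0)) - ys (f w0)) @[t --> (0 : R)^'+] -->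
    ys ('d f w0 v).
  have dv : t^-1 *: (f (t *: v + w0) - f w0) @[t --> (0 : R)^'] --> 'd f w0 v.
    by rewrite -deriveE//; exact: (@diff_derivable _ _ _ f w0 v df).
  rewrite (_ : (fun t => _) = ys \o (fun t => t^-1 *: (f (t *: v + w0) - f w0))).
    exact: continuous_cvg (cys _) (cvg_dnbhs_at_right dv).
  by apply/funext => t; rewrite /= (is_scalarZ lys) (is_scalarB lys).
apply/seteqP; split => [z [dz Hz]|_ ->].
  have zle v : z v <= ys ('d f w0 v).
    apply: (cvgr_to_ge (quot v)); near=> t.
    have t0 : 0 < t by near: t; exact: nbhs_right_gt.
    rewrite ler_pdivlMl// -(is_scalarZ dz.1).
    by have := Hz (t *: v + w0); rewrite addrK.
  apply/funext => v /=; apply/eqP; rewrite eq_le zle/=.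
  have := zle (- v); rewrite (is_scalarN dz.1) linearN (is_scalarN lys).
  by rewrite lerN2.
split=> // w /=; apply: (cvgr_to_le (quot (w - w0))); near=> t.
have t0 : 0 < t by near: t; exact: nbhs_right_gt.
have t1 : t <= 1 by near: t; apply: nbhs_right_le.
rewrite ler_pdivrMl//.
have t1' : 0 <= 1 - t by rewrite subr_ge0.
have := cphi t (1 - t) w w0 (ltW t0) t1' (subrKC _ _).
have -> : t *: w + (1 - t) *: w0 = t *: (w - w0) + w0.
  rewrite scalerBr scalerBl scale1r -[RHS]addrA.
  by congr (_ + _); rewrite addrC.
by rewrite /=; lra.
Unshelve. all: by end_near.
Qed.

Lemma convex_scalarization (R : realType) (U V Y : normedModType R)
    (K : set Y) (f : U * V -> Y) (ys : Y -> R) :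
  K 0 -> Kconvex (single f) K -> dual_cone K ys -> convex_fun (ys \o f).
Proof.
move=> K0 /convex_setP fK [[lys _] Kys] s t x y s0 t0 st.
have epif w : epi (single f) K (w, f w).
  by exists (f w) => //; exists 0 => //; rewrite addr0.
have [_ -> [k Kk /= fk]] := fK _ _ _ _ s0 t0 st (epif x) (epif y).
have := Kys _ Kk; rewrite -!(is_scalarZ lys) -(is_scalarD lys) -fk.
by rewrite (is_scalarD lys); lra.
Qed.

(** For y in f w + K, <ys, f w> <= <ys, y>, so bounded selections of f + K bound
    <ys, f> from above. *)
Lemma scalarization_bounded_above (R : realType) (U V Y : completeNormedModType R)
    (K : set Y) (f : U * V -> Y) (ys : Y -> R) (w0 : U * V) :
  K 0 -> Kconvex (single f) K -> Kclosed (single f) K -> dual_cone K ys ->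
  exists M, \forall w \near w0, ys (f w) <= M.
Proof.
move=> K0 fconv fcl [dys Kys].
have ftot w : exists y, epi (single f) K (w, y).
  by exists (f w), (f w) => //; exists 0 => //; rewrite addr0.
have [M HM] := locally_bounded_selection_prod w0 fcl fconv ftot.
have [c c0 cP] := dual_bounded dys.
exists (c * M); apply: filterS HM => w [y yM [_ -> [k Kk /= fk]]].
apply: (@le_trans _ _ (ys y)).
  by rewrite -fk (is_scalarD dys.1) lerDl; exact: Kys.
apply: le_trans (ler_norm _) _; apply: le_trans (cP y) _.
by rewrite ler_wpM2l.
Qed.

Lemma coderivative_scalarization (R : realType) (U V Y : normedModType R)
    (K : set Y) (f : U * V -> Y) (ys : Y -> R) (w0 : U * V) :
  K 0 -> dual_cone K ys ->
  coderivative (profile (single f) K) w0 (f w0) ys = subdifferential (ys \o f) w0.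
Proof.
move=> K0 [dys Kys]; apply/seteqP; split => z [dz].
  move=> [_ N]; split=> // w.
  have := N (w, f w); rewrite /Defs.dpair /= (is_scalarB dys.1).
  have gw : gph (profile (single f) K) (w, f w).
    by exists (f w) => //; exists 0 => //; rewrite addr0.
  by move=> /(_ gw); lra.
move=> Hz; split=> //; split; first exact: dual_dpair dz (dualN dys).
move=> [w y] [_ -> [k Kk /= <-]]; rewrite /Defs.dpair /=.
have := Hz w; have := Kys _ Kk.
by rewrite (is_scalarB dys.1) (is_scalarD dys.1) /=; lra.
Qed.

(** * The profile of the objective map *)

Lemma convex_cone0 (R : realType) (V : lmodType R) (K : set V) :
  convex_cone K -> K 0.
Proof. by move=> [[k Kk] KZ _]; rewrite -(scale0r k); exact: KZ. Qed.

Lemma convex_coneD (R : realType) (V : lmodType R) (K : set V) k l :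
  convex_cone K -> K k -> K l -> K (k + l).
Proof.
move=> [_ KZ /convex_setP cK] Kk Kl.
have half0 : 0 <= 2^-1 :> R by rewrite invr_ge0.
have half1 : 2^-1 + 2^-1 = 1 :> R by rewrite [RHS](splitr 1) !div1r.
have := KZ _ _ (ler0n R 2) (cK _ _ _ _ half0 half0 half1 Kk Kl).
by rewrite scalerDr !scalerA mulfV// !scale1r.
Qed.

Section objective_profile.
Context (R : realType) (P X Y : completeNormedModType R).
Context (K : set Y) (f : P * X -> Y) (C : P -> set X) (hK : convex_cone K).

Let K0 : K 0 := convex_cone0 hK.

Lemma objective_profile_convex : Kconvex (single f) K -> convex_set (gph C) ->
  convex_set (gph (profile (objective f C) K)).
Proof.
move=> /convex_setP fK /convex_setP cC; apply/convex_setP.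
move=> s t [p1 y1] [p2 y2] s0 t0 st [_ [x1 [C1 ->]] [k1 K1 /= <-]].
move=> [_ [x2 [C2 ->]] [k2 K2 /= <-]].
have Cx := cC _ _ (p1, x1) (p2, x2) s0 t0 st C1 C2.
have e1 : epi (single f) K ((p1, x1), f (p1, x1) + k1).
  by exists (f (p1, x1)) => //; exists k1.
have e2 : epi (single f) K ((p2, x2), f (p2, x2) + k2).
  by exists (f (p2, x2)) => //; exists k2.
have [_ -> [k Kk /= fk]] := fK _ _ _ _ s0 t0 st e1 e2.
exists (f (s *: (p1, x1) + t *: (p2, x2))); first by exists (s *: x1 + t *: x2).
by exists k.
Qed.

Lemma profile_PrMin_subset :
  gph (profile (proper_perturbation f C K) K) `<=` gph (profile (objective f C) K).
Proof. by move=> [p y] [a [Fa _] ka]; exists a. Qed.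

Lemma profile_dominated (p0 : P) (y0 : Y) :
  K_dominated_near (objective f C) (proper_perturbation f C K) K p0 ->
  \forall w \near (p0, y0), gph (profile (objective f C) K) w ->
    gph (profile (proper_perturbation f C K) K) w.
Proof.
move=> dom.
have : \forall w \near (p0, y0),
    objective f C w.1 `<=` sumset (proper_perturbation f C K w.1) K.
  exact: (@cvg_fst _ _ _ _ _ _ dom).
apply: filterS => -[p y] /= FP [a Fa [k Kk /= <-]].
have [b Pb [l Kl <-]] := FP a Fa; exists b => //; exists (l + k); first exact: convex_coneD.
by rewrite addrA.
Qed.

Section at_point.
Context (p0 : P) (x0 : X) (C0 : C p0 x0).

Let F0 k : K k -> gph (profile (objective f C) K) (p0, f (p0, x0) + k).
Proof. by move=> Kk; exists (f (p0, x0)); [exists x0|exists k]. Qed.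

(** The normality inequality at ybar + k reads <ys, k> >= 0. *)
Let Kcone_of_coderivative ys ps : dual_space ys ->
  coderivative (profile (objective f C) K) p0 (f (p0, x0)) ys ps -> dual_cone K ys.
Proof.
move=> dys [dps [_ N]]; split=> // k Kk; have := N _ (F0 Kk).
by rewrite /Defs.dpair /= subrr (is_scalar0 dps.1) add0r [f _ + k]addrC addrK; lra.
Qed.

(** The sum rule.  From left to right the sandwich theorem splits ps into a
    subgradient of <ys, f> and a normal to gph C; from right to left the two
    normality inequalities are added, and the components along X cancel. *)
Lemma coderivative_objective ys : Kconvex (single f) K -> Kclosed (single f) K ->
  convex_set (gph C) -> dual_space ys ->
  coderivative (profile (objective f C) K) p0 (f (p0, x0)) ys =
  \bigcup_(z in dual_pairs
      (coderivative (profile (single f) K) (p0, x0) (f (p0, x0)) ys))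
    [set z.1 \+ q | q in coderivative C p0 x0 z.2].
Proof.
move=> fconv fcl cC dys; apply/seteqP.
split => [ps Hps|ps [z [dz1 dz2 [_ [_ Nf]]]]].
  have Kys := Kcone_of_coderivative dys Hps.
  have [dps [_ N]] := Hps.
  rewrite (coderivative_scalarization _ _ K0 Kys).
  have cphi := convex_scalarization K0 fconv Kys.
  (* Everything is translated to w0, so that D contains 0 and g 0 = 0. *)
  pose w0 := (p0, x0).
  pose g v := ys (f (w0 + v)) - ys (f w0).
  pose h (v : P * X) := ps v.1.
  pose D := [set v | gph C (w0 + v)].
  have cg : convex_fun g.
    move=> s t x y s0 t0 st; have := cphi s t (w0 + x) (w0 + y) s0 t0 st.
    rewrite /g !scalerDr addrACA -scalerDl st scale1r /=.
    have : s * ys (f w0) + t * ys (f w0) = ys (f w0) by rewrite -mulrDl st mul1r.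
    lra.
  have g0 : g 0 = 0 by rewrite /g addr0 subrr.
  have lh : scalar h by move=> t x y; exact: dps.1.
  have cD : convex_set D.
    move: cC => /convex_setP cC; apply/convex_setP => s t x y s0 t0 st Dx Dy.
    have := cC _ _ _ _ s0 t0 st Dx Dy.
    by rewrite !scalerDr addrACA -scalerDl st scale1r.
  have D0 : D 0 by rewrite /D /= addr0.
  have hg d : D d -> h d <= g d.
    move=> Dd.
    have /N : gph (profile (objective f C) K) (p0 + d.1, f (w0 + d)).
      exists (f (w0 + d)); first by exists (x0 + d.2).
      by exists 0 => //; rewrite addr0.
    by rewrite /Defs.dpair /g /h /= addrAC subrr add0r (is_scalarB dys.1); lra.
  have [l [ll lg hl]] := sandwich_convex cg g0 lh cD D0 hg.
  have dl : dual_space l.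
    have [M HM] := scalarization_bounded_above w0 K0 fconv fcl Kys.
    apply: (scalar_bounded_above_dual (M := M - ys (f w0)) ll).
    move: HM => /nbhs0P; apply: filterS => v HM.
    by apply: le_trans (lg v) _; rewrite /g lerD2r.
  exists (fun p => l (p, 0), fun x => l (0, x)).
    split=> /=; [exact: dual_inl|exact: dual_inr|].
    rewrite (dpair_inl_inr ll); split=> // w.
    by have := lg (w - w0); rewrite /g subrKC.
  have dl1 := dual_inl dl; have dl2 := dual_inr dl.
  exists (ps \+ (\- (fun p => l (p, 0)))).
    have dq := dualD dps (dualN dl1).
    split=> //; split; first exact: dual_dpair dq (dualN dl2).
    move=> w Cw; have := hl (w - w0); rewrite /D /= subrKC => /(_ Cw).
    rewrite -{1}(dpair_inl_inr ll) /Defs.dpair /h /=; lra.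
  by apply/funext => p /=; lra.
move=> [q [dq [_ NC]] <-].
split; first exact: dualD.
split; first exact: dual_dpair (dualD dz1 dq) (dualN dys).
move=> [p y] [_ [x [Cx ->]] [k Kk /= <-]].
have /Nf : gph (profile (single f) K) ((p, x), f (p, x) + k).
  by exists (f (p, x)) => //; exists k.
have := NC (p, x) Cx.
by rewrite /Defs.dpair /=; lra.
Qed.

End at_point.
End objective_profile.

(** * Partial derivatives *)

Lemma diff_slice_l (R : realType) (U V W : normedModType R) (f : U * V -> W) u0 v0 h :
  differentiable f (u0, v0) ->
  'd (fun u => f (u, v0)) u0 h = 'd f (u0, v0) (h, 0).
Proof.
move=> df.
have dg : differentiable (fun u => f (u, v0)) u0.
  by apply: (@differentiable_comp _ _ _ _ (fun u => (u, v0)) f).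
rewrite -!deriveE// /derive.
apply: (congr1 (fun g : R -> W => lim (g @ 0^'))); apply/funext => t /=.
have -> // : t *: (h, 0) + (u0, v0) = (t *: h + u0, v0) :> U * V.
by congr pair; rewrite /= scaler0 add0r.
Qed.

Lemma diff_slice_r (R : realType) (U V W : normedModType R) (f : U * V -> W) u0 v0 h :
  differentiable f (u0, v0) ->
  'd (fun v => f (u0, v)) v0 h = 'd f (u0, v0) (0, h).
Proof.
move=> df.
have dg : differentiable (fun v => f (u0, v)) v0.
  by apply: (@differentiable_comp _ _ _ _ (fun v => (u0, v)) f).
rewrite -!deriveE// /derive.
apply: (congr1 (fun g : R -> W => lim (g @ 0^'))); apply/funext => t /=.
have -> // : t *: (0, h) + (u0, v0) = (u0, t *: h + v0) :> U * V.
by congr pair; rewrite /= scaler0 add0r.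
Qed.

(** * The coderivative formulas *)

Theorem theorem4 (R : realType) (P X Y : completeNormedModType R)
    (K : set Y) (f : P * X -> Y) (C : P -> set X)
    (pbar : P) (xbar : X) (ybar : Y)
    (hKcone : convex_cone K) (hKclosed : closed K) (hKpointed : pointed K)
    (hfconvex : Kconvex (single f) K) (hfclosed : Kclosed (single f) K)
    (hCproper : proper_map C)
    (hCclosed : closed (gph C)) (hCconvex : convex_set (gph C))
    (hS : gph (solution_map f C K) (pbar, xbar))
    (hybar : ybar = f (pbar, xbar))
    (hi : closed_subspace
            (cone_hull (diffset (rge (graph_map C)) (sdom (single f)))))
    (hii : closed_subspace (cone_hull (diffset [set: P] (sdom C))))
    (hdom : K_dominated_near (objective f C) (proper_perturbation f C K) K pbar) :
  let DPK := frechet_coderivative (profile (proper_perturbation f C K) K)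
               pbar ybar in
  let DfK := coderivative (profile (single f) K) (pbar, xbar) (f (pbar, xbar)) in
  let DC := coderivative C pbar xbar in
  [/\ (forall ys : Y -> R, dual_space ys ->
         DPK ys =
         \bigcup_(z in dual_pairs (DfK ys)) [set z.1 \+ q | q in DC z.2]),
      (forall ys : Y -> R, dual_cone K ys ->
         DPK ys =
         \bigcup_(z in dual_pairs (subdifferential (ys \o f) (pbar, xbar)))
           [set z.1 \+ q | q in DC z.2]) &
      (continuously_differentiable_at f (pbar, xbar) ->
       forall ys : Y -> R, dual_cone K ys ->
         DPK ys =
         [set grad_p_adj f pbar xbar ys \+ q
            | q in DC (grad_x_adj f pbar xbar ys)])].
Proof.
move=> DPK DfK DC.
have [C0 _] := hS.
have K0 := convex_cone0 hKcone.
have cones : frechet_normal_cone (pbar, ybar)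
    (gph (profile (proper_perturbation f C K) K)) =
    normal_cone (pbar, ybar) (gph (profile (objective f C) K)).
  apply: frechet_normal_cone_locally_convex.
  - exact: objective_profile_convex.
  - by exists ybar; [exists xbar|exists 0 => //; rewrite addr0].
  - exact: profile_PrMin_subset.
  - exact: profile_dominated.
have DPKE ys : DPK ys = coderivative (profile (objective f C) K) pbar ybar ys.
  by rewrite /DPK /frechet_coderivative cones.
have part1 ys : dual_space ys -> DPK ys =
    \bigcup_(z in dual_pairs (DfK ys)) [set z.1 \+ q | q in DC z.2].
  by move=> dys; rewrite DPKE hybar; exact: coderivative_objective.
have part2 ys : dual_cone K ys -> DPK ys =
    \bigcup_(z in dual_pairs (subdifferential (ys \o f) (pbar, xbar)))
      [set z.1 \+ q | q in DC z.2].
  by move=> Kys; rewrite part1; [rewrite /DfK coderivative_scalarization|case: Kys].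
split=> // -[/nbhs_singleton df _] ys Kys.
have [dys _] := Kys.
rewrite part2// subdifferential_diff//; last exact: convex_scalarization Kys.
have gp : grad_p_adj f pbar xbar ys = fun h => (ys \o 'd f (pbar, xbar)) (h, 0).
  by apply/funext => h; rewrite /grad_p_adj /= diff_slice_l.
have gx : grad_x_adj f pbar xbar ys = fun h => (ys \o 'd f (pbar, xbar)) (0, h).
  by apply/funext => h; rewrite /grad_x_adj /= diff_slice_r.
have -> : dual_pairs [set ys \o 'd f (pbar, xbar)] =
    [set (grad_p_adj f pbar xbar ys, grad_x_adj f pbar xbar ys)].
  have dd : dual_space (ys \o 'd f (pbar, xbar)).
    by apply: dual_comp => //; [exact: linearP|exact: diff_continuous].
  apply/seteqP; split => [[z1 z2] /= [dz1 dz2 zE]|_ ->].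
    have z10 : z1 0 = 0 := is_scalar0 dz1.1.
    have z20 : z2 0 = 0 := is_scalar0 dz2.1.
    rewrite gp gx -zE /Defs.dpair /= z10 z20.
    by congr pair; apply/funext => h; rewrite ?addr0 ?add0r.
  rewrite gp gx; split; [exact: dual_inl dd|exact: dual_inr dd|].
  exact: dpair_inl_inr dd.1.
by rewrite bigcup_set1.
Qed.
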